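(* Let $A\subset [0,1]$ be a Lebesgue measurable set such that there exist no $x,y,z\in A$ with $x+y=3z$. Then the Lebesgue measure of $A$ satisfies $|A|\le \frac{1}{2}-\frac{1}{114}$.
   Context: $|A|$ denotes the Lebesgue measure of $A$. The condition forbids all solutions $x,y,z\in A$ of $x+y=3z$, with $x,y,z$ not required to be distinct. *)

(* Defs.v *)
From mathcomp Require Export all_boot all_order all_algebra.
From mathcomp Require Export all_classical all_reals all_analysis.
Set Implicit Arguments.
Unset Strict Implicit.
Unset Printing Implicit Defensive.
Import Order.TTheory GRing.Theory Num.Theory.
Local Open Scope classical_set_scope.
Local Open Scope ring_scope.

(* The library's [measurable] on R is Borel; this is Caratheodory measurability
   for the Lebesgue outer measure, i.e. the domain of
   [completed_lebesgue_measure]. *)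
Definition lebesgue_measurable (R : realType) (A : set R) : Prop :=
  (wlength (@idfun R))^*%mu.-cara.-measurable A.

(* Main.v *)
Require Import Defs.
From mathcomp Require Import measurable_realfun lra ring zify.
Import Order.TTheory GRing.Theory Num.Theory.
Import numFieldNormedType.Exports.
Set Implicit Arguments.
Unset Strict Implicit.
Unset Printing Implicit Defensive.
Local Open Scope classical_set_scope.
Local Open Scope ring_scope.

(* By inner regularity it suffices to bound a compact solution-free set K >= 0
   with minimum m and maximum M, and one gets |K| <= 22/45 M.

   Raikov's inequality |X + Y| >= min(1, |X| + |Y|) on the circle R/Z, applied
   to K modulo M - m, yields |K + K| >= min(3|K|, |K| + M - m). As K + K and the
   part of 3K in [0, 2M] are disjoint subsets of [2m, 2M], this gives
   |K| <= M/2 - m/4, and, for C = K `&` [2M/3, M] and d = M/3 - |C|,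
   4|K| + 3d <= 2M or 6|K| + 3d <= 3M.
   Since 3K avoids C + C and x + C for x in K, the set K has measure at most
   2d/3 in [4M/9, 2M/3] and d/3 in [2M/9 + x/3, M/3 + x/3]. Taking x = m and
   x = max (K `&` [M/3, 4M/9]), and using |K| <= M/2 - m/4 for the solution-free
   set K `&` [0, 2M/9 + m/3], one finds |K| <= 13M/27 + d/3. *)

(** * Lebesgue length of sets of reals, affine maps and compactness *)

Section length.
Context {R : realType}.
Implicit Types (A B K : set R) (a b c e k x y : R).
Local Notation mu := (@lebesgue_measure R).

(** Real-valued so that linear arithmetic applies; a set of infinite measure gets 0, hence the
    finiteness hypotheses [mfin] in the lemmas that follow. *)
Definition len A : R := fine (mu A).

Definition mfin A := measurable A /\ (mu A < +oo)%E.

Lemma mfin_fin_num A : mfin A -> mu A \is a fin_num.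
Proof. by case=> _ Afin; rewrite ge0_fin_numE. Qed.

Lemma mfinS A B : measurable A -> mfin B -> A `<=` B -> mfin A.
Proof.
move=> mA [mB Bfin] AB; split=> //.
by apply: le_lt_trans Bfin; exact: le_outer_measure.
Qed.

Lemma mfin_itv a b : mfin `[a, b].
Proof.
split=> //; rewrite lebesgue_measure_itv/=; case: ifP => // _.
by rewrite -EFinB ltry.
Qed.

Lemma compact_mfin K : compact K -> mfin K.
Proof. by move=> cK; split; [exact: compact_measurable|exact: compact_finite_measure]. Qed.

Lemma len_ge0 A : 0 <= len A.
Proof. exact/fine_ge0. Qed.

Lemma lenE A : mfin A -> mu A = (len A)%:E.
Proof. by move=> mA; rewrite fineK// mfin_fin_num. Qed.

Lemma mfinU A B : mfin A -> mfin B -> mfin (A `|` B).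
Proof.
move=> mA mB; split; first exact: (measurableU _ _ mA.1 mB.1).
rewrite (@le_lt_trans _ _ (mu A + mu B)%E)//; first exact: outer_measureU2.
by rewrite !lenE// -EFinD ltry.
Qed.

Lemma mfinIl A B : mfin A -> measurable B -> mfin (A `&` B).
Proof. by move=> mA mB; apply: (mfinS _ mA); [exact: measurableI mA.1 mB|exact: subIsetl]. Qed.

Lemma le_len A B : mfin B -> A `<=` B -> len A <= len B.
Proof.
move=> mB AB; have le_AB : (mu A <= mu B)%E by exact: le_outer_measure.
apply: fine_le => //; last exact: mfin_fin_num.
by rewrite ge0_fin_numE// (le_lt_trans le_AB)//; case: mB.
Qed.

Lemma lenUI A B : mfin A -> mfin B -> len (A `|` B) + len (A `&` B) = len A + len B.
Proof.
move=> mA mB; have mAB := mfinIl mA mB.1.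
have : mu (A `|` B) = (mu A + mu B - mu (A `&` B))%E.
  exact: (measureUfinl (mu := mu) mA.1 mB.1 mA.2).
rewrite !lenE//; last exact: mfinU.
by move=> [->]; rewrite subrK.
Qed.

Lemma len_set0 : len set0 = 0.
Proof. by rewrite /len measure0. Qed.

Lemma len_itv a b : a <= b -> len `[a, b] = b - a.
Proof.
rewrite /len lebesgue_measure_itv/= lte_fin le_eqVlt => /predU1P[->|->//].
by rewrite ltxx subrr.
Qed.

Lemma lenU_le A B : mfin A -> mfin B -> len (A `|` B) <= len A + len B.
Proof. by move=> mA mB; rewrite -lenUI// lerDl len_ge0. Qed.

Lemma len_disjU A B : mfin A -> mfin B -> A `&` B = set0 ->
  len (A `|` B) = len A + len B.
Proof. by move=> mA mB AB0; rewrite -lenUI// AB0 len_set0 addr0. Qed.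

(** The two pieces overlap at most in the point b, which is null. *)
Lemma len_split A a b c : measurable A -> a <= b <= c ->
  len (A `&` `[a, c]) = len (A `&` `[a, b]) + len (A `&` `[b, c]).
Proof.
move=> mA /andP[ab bc].
have fI x y : mfin (A `&` `[x, y]) by rewrite setIC; apply: mfinIl => //; exact: mfin_itv.
rewrite -lenUI// [len (_ `&` (A `&` _))](_ : _ = 0) ?addr0; last first.
  apply/le_anti; rewrite len_ge0 andbT -(subrr b) -len_itv//.
  apply: le_len; first exact: mfin_itv.
  move=> x [[_ /=]]; rewrite !in_itv/= => /andP[_ xb] [_ /andP[bx _]].
  by rewrite bx xb.
rewrite -setIUr; congr (len (_ `&` _)); apply/seteqP; split=> x /=; rewrite !in_itv/=.
  case/andP=> ax xc; case: (lerP x b) => xb; first by left; apply/andP.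
  by right; apply/andP; split=> //; exact: ltW.
by case=> /andP[? ?]; apply/andP; split; lra.
Qed.

Lemma measurable_affine A k c : measurable A -> measurable [set x | A (k * x + c)].
Proof.
move=> mA; rewrite -[X in measurable X]setTI.
have : measurable_fun setT (fun x : R => k * x + c).
  apply: continuous_measurable_fun => x; apply: cvgD; last exact: cvg_cst.
  by apply: cvgM; [exact: cvg_cst|exact: cvg_id].
exact.
Qed.

(** By uniqueness of Lebesgue measure: k times its pushforward under x -> k x + c gives every
    half-open interval its length. *)
Lemma lebesgue_measure_affine A k c : 0 < k -> measurable A ->
  mu [set x | A (k * x + c)] = (k^-1%:E * mu A)%E.
Proof.
move=> k0 mA.
pose f (x : measurableTypeR R) : measurableTypeR R := k * x + c.
have mf : measurable_fun setT f.
  by move=> _ B mB; rewrite setTI; exact: measurable_affine.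
pose nu := mscale (NngNum (ltW k0)) (pushforward mu f).
suff : mu A = nu mf A.
  move=> /(congr1 (fun z => k^-1%:E * z)%E) ->.
  by rewrite /nu/= /mscale/= muleA -EFinM mulVf ?gt_eqF// mul1e.
apply: lebesgue_measure_unique => // _ [[a b] _ <-] /=.
rewrite /nu /mscale/= /pushforward.
have -> : f @^-1` `]a, b] = `](a - c) / k, (b - c) / k]%classic.
  apply/seteqP; split=> x /=; rewrite !in_itv/= /f.
    by move=> /andP[h1 h2]; rewrite ltr_pdivrMr// ler_pdivlMr//; apply/andP; split; lra.
  by rewrite ltr_pdivrMr// ler_pdivlMr// => /andP[h1 h2]; apply/andP; split; lra.
rewrite !lebesgue_measure_itv/= !lte_fin ltr_pM2r ?invr_gt0// ltrD2r.
case: ifP => _; last by rewrite mule0.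
by rewrite -!EFinB -EFinM; congr EFin; field; rewrite gt_eqF.
Qed.

Lemma mfin_affine A k c : 0 < k -> mfin A -> mfin [set x | A (k * x + c)].
Proof.
move=> k0 mA; split; first exact: measurable_affine mA.1.
by rewrite lebesgue_measure_affine//; [rewrite lenE// -EFinM ltry|exact: mA.1].
Qed.

Lemma len_affine A k c : 0 < k -> mfin A -> len [set x | A (k * x + c)] = k^-1 * len A.
Proof.
by move=> k0 mA; rewrite {1}/len lebesgue_measure_affine//; [rewrite lenE|exact: mA.1].
Qed.

Lemma len_translate A e : mfin A -> len [set x | A (x + e)] = len A.
Proof.
move=> mA; rewrite -[RHS]mul1r -[in RHS]invr1 -(@len_affine _ _ e)//.
by congr len; apply/seteqP; split=> x /=; rewrite mul1r.
Qed.

Lemma mfin_translate A e : mfin A -> mfin [set x | A (x + e)].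
Proof.
move=> mA; rewrite (_ : [set _ | _] = [set x | A (1 * x + e)]).
  exact: mfin_affine.
by apply/seteqP; split=> x /=; rewrite mul1r.
Qed.

Definition sumset A B := [set x | exists a b, [/\ A a, B b & x = a + b]].

Lemma compact_sumset A B : compact A -> compact B -> compact (sumset A B).
Proof.
move=> cA cB.
have -> : sumset A B = (fun p => p.1 + p.2) @` (A `*` B).
  apply/seteqP; split=> x /=.
    by move=> [a [b [Aa Bb ->]]]; exists (a, b).
  by move=> [[a b] /= [Aa Bb] <-]; exists a, b.
apply: continuous_compact; last exact: compact_setX.
apply: continuous_subspaceT => x.
by apply: cvgD; [exact: cvg_fst|exact: cvg_snd].
Qed.

Lemma compact_minP K : compact K -> K !=set0 ->
  exists2 m, K m & forall x, K x -> m <= x.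
Proof.
move=> cK K0; have [|m /set_mem Km H] := @compact_EVT_min _ R id K K0 cK.
  by apply: continuous_subspaceT => x; exact: cvg_id.
by exists m => // x Kx; apply: H; exact: mem_set.
Qed.

Lemma compact_maxP K : compact K -> K !=set0 ->
  exists2 M, K M & forall x, K x -> x <= M.
Proof.
move=> cK K0; have [|m /set_mem Km H] := @compact_EVT_max _ R id K K0 cK.
  by apply: continuous_subspaceT => x; exact: cvg_id.
by exists m => // x Kx; apply: H; exact: mem_set.
Qed.

Lemma compactI_itv K a b : compact K -> compact (K `&` `[a, b]).
Proof. by move=> cK; apply: compact_closedI => //; exact: itv_closed. Qed.

Lemma closed_affine A k c : closed A -> closed [set x | A (k * x + c)].
Proof.
move=> cA; apply: (@continuous_closedP _ _ (fun x : R => k * x + c)).1 => // x.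
apply: cvgD; last exact: cvg_cst.
by apply: cvgM; [exact: cvg_cst|exact: cvg_id].
Qed.

End length.

(** * The circle R/Z, modelled by periodic subsets of the line *)

Section circle.
Context {R : realType}.
Implicit Types (A B K X Y : set R) (a b c e k x y : R) (n : int).
Local Notation mu := (@lebesgue_measure R).

Definition periodic X := forall n x, X x -> X (x + n%:~R).

(** This is the translate X - e, not X + e. *)
Definition shift e X := [set x | X (x + e)].

(** For periodic X, the Haar probability measure of its image in R/Z; counting both endpoints is
    harmless, as points are null. *)
Definition clen X := len (X `&` `[0, 1]).

Definition periodize K := [set x | exists n, K (x + n%:~R)].

Lemma periodic_iff X n x : periodic X -> X (x + n%:~R) <-> X x.
Proof.
by move=> pX; split=> [/(pX (- n))|]; [rewrite mulrNz addrK|exact: pX].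
Qed.

Lemma periodic_shift e X : periodic X -> periodic (shift e X).
Proof. by move=> pX n x; rewrite /shift/= addrAC; exact: pX. Qed.

Lemma periodicI X Y : periodic X -> periodic Y -> periodic (X `&` Y).
Proof. by move=> pX pY n x [Xx Yx]; split; [exact: pX|exact: pY]. Qed.

Lemma periodicU X Y : periodic X -> periodic Y -> periodic (X `|` Y).
Proof. by move=> pX pY n x [Xx|Yx]; [left; exact: pX|right; exact: pY]. Qed.

Lemma periodic_periodize K : periodic (periodize K).
Proof.
move=> n x [i Kx]; exists (i - n).
by rewrite (_ : x + _ + _ = x + i%:~R)// mulrzDr mulrNz; ring.
Qed.

Lemma periodic_mod1 x : exists2 n : int, 0 <= x + n%:~R & x + n%:~R < 1.
Proof.
have /andP[l u] := floor_itv x.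
exists (- Num.floor x); rewrite mulrNz ?subr_ge0//.
by move: u; rewrite mulrzDr; lra.
Qed.

Lemma measurable_shift e X : measurable X -> measurable (shift e X).
Proof.
move=> mX; rewrite (_ : shift e X = [set x | X (1 * x + e)]); first exact: measurable_affine.
by apply/seteqP; split=> x /=; rewrite mul1r.
Qed.

Lemma closed_shift e X : closed X -> closed (shift e X).
Proof.
move=> mX; rewrite (_ : shift e X = [set x | X (1 * x + e)]); first exact: closed_affine.
by apply/seteqP; split=> x /=; rewrite mul1r.
Qed.

Lemma mfinI_itv X a b : measurable X -> mfin (X `&` `[a, b]).
Proof. by move=> mX; rewrite setIC; apply: mfinIl => //; exact: mfin_itv. Qed.

(** Reduce e to r in [0, 1) by periodicity. The window becomes [r, 1 + r]; its part beyond 1 is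
    moved back to [0, r]. *)
Lemma clen_shift e X : measurable X -> periodic X -> clen (shift e X) = clen X.
Proof.
move=> mX pX; have [n r0 r1] := periodic_mod1 e; set r := e + n%:~R in r0 r1.
have -> : shift e X = shift r X.
  apply/seteqP; split=> x; rewrite /shift/= /r addrA => Xx; first exact: pX.
  exact/(periodic_iff n _ pX).
have -> : clen (shift r X) = len (X `&` `[r, 1 + r]).
  rewrite -(len_translate r); last exact: mfinI_itv.
  congr len; apply/seteqP; split=> x; rewrite /shift/= !in_itv/= => -[Xx /andP[? ?]].
    by split=> //; apply/andP; split; lra.
  by split=> //; apply/andP; split; lra.
rewrite (@len_split _ _ r 1)//; last by apply/andP; split; lra.
have -> : len (X `&` `[1, 1 + r]) = len (X `&` `[0, r]).
  rewrite -(len_translate 1); last exact: mfinI_itv.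
  congr len; apply/seteqP; split=> x; rewrite /= !in_itv/= => -[Xx /andP[? ?]].
    by split; [exact/(periodic_iff 1 _ pX)|apply/andP; split; lra].
  by split; [exact/(periodic_iff 1 _ pX)|apply/andP; split; lra].
by rewrite addrC -len_split//; apply/andP; split; lra.
Qed.

Lemma compact_symmetric_bound K : compact K -> exists b, forall x, K x -> `|x| <= b.
Proof.
move=> cK; have [->|/set0P K0] := eqVneq K set0; first by exists 0.
have [m _ hm] := compact_minP cK K0; have [M _ hM] := compact_maxP cK K0.
exists (`|m| + `|M|) => x Kx; have := hm _ Kx; have := hM _ Kx.
by rewrite ler_norml; case: (ger0P m); case: (ger0P M) => *; apply/andP; split; lra.
Qed.

(** The union of integer translates is locally finite: only finitely many of them meet the unit ball
    around a given x, and a finite union of closed sets is closed. *)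
Lemma closed_periodize K : compact K -> closed (periodize K).
Proof.
move=> cK; have clK : closed K by apply: compact_closed => //; exact: Rhausdorff.
have [b hb] := compact_symmetric_bound cK.
apply/closure_id/seteqP; split=> [|x clx]; first exact: subset_closure.
(* If y is within 1 of x and y + n is in K, then |n| <= N. The index i in 0..2N stands for n = i -
   N. *)
pose N := Num.bound (`|b| + `|x| + 1).
pose F (i : nat) := [set y | K (y + (i%:Z - N%:Z)%:~R)].
have clF : closed (\bigcup_(i in `I_N.*2.+1) F i).
  apply: closed_bigcup => [|i _]; first exact: finite_II.
  exact: closed_shift.
suff : (\bigcup_(i in `I_N.*2.+1) F i) x by move=> [i _ Fi]; exists (i%:Z - N%:Z).
rewrite ((closure_id _).1 clF) => B Bx.
have [y [[n Kyn] [By]]] : (periodize K `&` (B `&` ball x 1)) !=set0.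
  by apply: clx; apply: filterI => //; exact: nbhsx_ballx.
rewrite /ball/= => xy1; exists y; split=> //.
have Nb : `|b| + `|x| + 1 < N%:R by exact: archi_boundP.
have nN : `|n| <= N%:Z.
  have := hb _ Kyn => yn.
  rewrite -(ler_int R) intr_norm ltW// (le_lt_trans _ Nb)//.
  have -> : (n%:~R : R) = (y + n%:~R) + (x - y) - x by ring.
  rewrite (le_trans (ler_normB _ _))// (le_trans (lerD (ler_normD _ _) (lexx _)))//.
  by have := ler_norm b; lra.
exists (absz (n + N%:Z)) => /=; first by lia.
by rewrite /F/= (_ : (absz (n + N%:Z))%:Z - N%:Z = n)//; lia.
Qed.

(** The sum is the periodization of the compact sum of the parts of X and Y in [0, 1]. *)
Lemma closed_sumset X Y : closed X -> closed Y -> periodic X -> periodic Y ->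
  closed (sumset X Y).
Proof.
move=> cX cY pX pY.
have c01 (Z : set R) : closed Z -> compact (Z `&` `[0, 1]).
  by move=> cZ; rewrite setIC; apply: compact_closedI => //; exact: segment_compact.
rewrite (_ : sumset X Y = periodize (sumset (X `&` `[0, 1]) (Y `&` `[0, 1]))).
  by apply: closed_periodize; apply: compact_sumset; exact: c01.
apply/seteqP; split=> x.
  move=> [a [b [Xa Yb ->]]].
  have [i i0 i1] := periodic_mod1 a; have [j j0 j1] := periodic_mod1 b.
  exists (i + j), (a + i%:~R), (b + j%:~R); split; last by rewrite mulrzDr; ring.
    by split; [exact: pX|rewrite /= in_itv/= i0 ltW].
  by split; [exact: pY|rewrite /= in_itv/= j0 ltW].
move=> [n [a [b [[Xa _] [Yb _] xE]]]].
exists (a + (- n)%:~R), b; split=> //; first exact: pX.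
by rewrite mulrNz addrAC -xE addrK.
Qed.

Lemma clen_ge0 X : 0 <= clen X. Proof. exact: len_ge0. Qed.

Lemma clen_le1 X : clen X <= 1.
Proof.
rewrite -[leRHS]subr0 -len_itv//; apply: le_len; first exact: mfin_itv.
exact: subIsetr.
Qed.

Lemma le_clen X Y : measurable Y -> X `<=` Y -> clen X <= clen Y.
Proof. by move=> mY XY; apply: le_len; [exact: mfinI_itv|exact: setSI]. Qed.

Lemma clenUI X Y : measurable X -> measurable Y ->
  clen (X `|` Y) + clen (X `&` Y) = clen X + clen Y.
Proof.
move=> mX mY; rewrite /clen -(lenUI (mfinI_itv 0 1 mX) (mfinI_itv 0 1 mY)).
by rewrite setIUl setIIl.
Qed.

End circle.

(** * Raikov's inequality on the circle *)

Section raikov.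
Context {R : realType}.
Implicit Types (A B K X Y : set R) (a b c e k x y h : R) (n : int).
Local Notation mu := (@lebesgue_measure R).

(** Outer regularity gives an open U around P with U minus P of measure below e. By compactness P +
    h stays in U for small h, so h carries the points counted here into U minus P. *)
Lemma clen_setD_shift_small X e : closed X -> periodic X -> 0 < e ->
  \forall h \near 0, clen (X `\` shift h X) <= e.
Proof.
move=> cX pX e0; set P := X `&` `[0, 1].
have cP : compact P.
  by rewrite /P setIC; apply: compact_closedI => //; exact: segment_compact.
have mP := compact_mfin cP.
have [U [oU PU Ue]] := lebesgue_regularity_outer mP.1 mP.2 e0.
have mUP : mfin (U `\` P).
  split; last by rewrite (lt_trans Ue)// ltry.
  by apply: measurableD mP.1; exact: open_measurable.
have near_U : \forall h \near 0, P `<=` (fun x => U (x + h)).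
  have := (compact_near_coveringP P).1 cP R (nbhs (0 : R)) (fun h x => U (x + h)) _.
  apply=> x Px.
  apply: (@add_continuous R (x, 0) U); rewrite /= addr0.
  by apply: open_nbhs_nbhs; split => //; exact: PU.
near=> h; apply: (@le_trans _ _ (len (U `\` P))); last first.
  by rewrite -lee_fin -lenE// ltW.
rewrite -(len_translate h mUP); apply: le_len; first exact: mfin_translate.
move=> x [[Xx nXx] x01]; split; last by move=> [].
have PUh : P `<=` (fun x => U (x + h)) by near: h.
exact: PUh.
Unshelve. all: by end_near. Qed.

(** The cross-correlation of the indicator functions of X and Y on the circle. *)
Definition corr X Y e := clen (Y `&` shift e X).

(** Points lost on passing from e to e + h lie in a translate of X minus (X - h), whose measure does
    not depend on e. Used with increments of both signs, this gives continuity. *)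
Lemma corr_le X Y e h : measurable X -> measurable Y -> periodic X ->
  corr X Y e <= corr X Y (e + h) + clen (X `\` shift h X).
Proof.
move=> mX mY pX; have mXs t : measurable (shift t X) by exact: measurable_shift.
have mD : measurable (X `\` shift h X) by exact: measurableD.
have pD : periodic (X `\` shift h X).
  move=> n x [Xx nXx]; split; first exact: pX.
  by move=> Xxn; apply: nXx; exact: (periodic_iff n x (@periodic_shift _ h _ pX)).1.
rewrite -(clen_shift e mD pD) /corr -clenUI; last 2 first.
  exact: measurableI.
  exact: measurable_shift.
apply: ler_wpDr; first exact: clen_ge0.
apply: le_clen; first by apply: measurableU; [exact: measurableI|exact: measurable_shift].
move=> x [Yx Xx]; have [Xh|nXh] := pselect (X (x + e + h)); last by right.
by left; split=> //; rewrite /shift/= addrA.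
Qed.

Lemma corr_continuous X Y : closed X -> closed Y -> periodic X ->
  continuous (corr X Y).
Proof.
move=> cX cY pX e; have mX := closed_measurable cX; have mY := closed_measurable cY.
apply/cvgrPdist_le => eps eps0.
have small := clen_setD_shift_small cX pX eps0.
have near1 : \forall t \near e, clen (X `\` shift (t - e) X) <= eps.
  have : (fun t : R => t - e) @ e --> (0 : R).
    by rewrite -(subrr e); apply: cvgB; [exact: cvg_id|exact: cvg_cst].
  by move=> /(_ _ small).
have near2 : \forall t \near e, clen (X `\` shift (e - t) X) <= eps.
  have : (fun t : R => e - t) @ e --> (0 : R).
    by rewrite -(subrr e); apply: cvgB; [exact: cvg_cst|exact: cvg_id].
  by move=> /(_ _ small).
near=> t; rewrite ler_norml.
have h1 := @corr_le X Y e (t - e) mX mY pX.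
have h2 := @corr_le X Y t (e - t) mX mY pX.
have s1 : clen (X `\` shift (t - e) X) <= eps by near: t.
have s2 : clen (X `\` shift (e - t) X) <= eps by near: t.
by move: h1 h2; rewrite ![_ + (_ - _)]addrC !subrK => h1 h2; apply/andP; split; lra.
Unshelve. all: by end_near. Qed.

(** Tonelli for the set of pairs (e, y) with y + e in X: sections at fixed e measure the
    correlation, sections at fixed y in Y a translate of X. *)
Lemma integral_corr X Y : measurable X -> measurable Y -> periodic X ->
  (\int[mu]_(e in `[0%R, 1%R]) (corr X Y e)%:E = (clen X * clen Y)%:E)%E.
Proof.
move=> mX mY pX.
pose T := measurableTypeR R.
pose A : set (T * T) :=
  [set p | [/\ `[0, 1]%classic p.1, (Y `&` `[0, 1]) p.2 & X (p.2 + p.1)]].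
have mA : measurable A.
  have m1 : measurable_fun setT (fst : T * T -> T) by exact: measurable_fst.
  have m2 : measurable_fun setT (snd : T * T -> T) by exact: measurable_snd.
  have m3 : measurable_fun setT (fun p : T * T => (p.2 + p.1 : T)) by exact: measurable_funD.
  have -> : A = (fst @^-1` `[0, 1]) `&`
      ((snd @^-1` (Y `&` `[0, 1])) `&` ((fun p => p.2 + p.1) @^-1` X)).
    by apply/seteqP; split=> p /= => [[]|[? []]].
  apply: measurableI; first by rewrite -[X in measurable X]setTI; exact: m1.
  apply: measurableI.
    by rewrite -[X in measurable X]setTI; apply: m2 => //; exact: measurableI.
  by rewrite -[X in measurable X]setTI; exact: m3.
have := @indic_fubini_tonelli _ _ T T R mu mu A mA.
rewrite (indic_fubini_tonelli_FE mu mA) (indic_fubini_tonelli_GE mu mA).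
have -> : (\int[mu]_x (mu \o xsection A) x = \int[mu]_(e in `[0%R, 1%R]) (corr X Y e)%:E)%E.
  rewrite [RHS]integral_mkcond; apply: eq_integral => x _; rewrite patchE /= xsectionE.
  case: ifPn => [/set_mem x01|/negP nx01]; last first.
    rewrite (_ : _ @^-1` A = set0) ?measure0//; apply/seteqP; split=> // y [/= x01 _ _].
    by apply: nx01; exact: mem_set.
  rewrite -lenE; last by apply: mfinI_itv; apply: measurableI => //; exact: measurable_shift.
  by congr (mu _); apply/seteqP; split=> y [] => [_ [? ?] ?|[? ?] ?]; split.
move=> ->.
have -> : (\int[mu]_y (mu \o ysection A) y =
    \int[mu]_(y in Y `&` `[0%R, 1%R]) cst (clen X)%:E y)%E.
  rewrite [RHS]integral_mkcond; apply: eq_integral => y _; rewrite patchE /= ysectionE.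
  case: ifPn => [/set_mem Yy|/negP nYy]; last first.
    rewrite (_ : _ @^-1` A = set0) ?measure0//; apply/seteqP; split=> // x [/= _ Yy _].
    by apply: nYy; exact: mem_set.
  rewrite -(clen_shift y mX pX) -lenE; last by apply: mfinI_itv; exact: measurable_shift.
  congr (mu _); apply/seteqP; split=> x.
    by move=> [/= x01 _ Xx]; split=> //; rewrite /shift/= addrC.
  by move=> [Xx x01]; split=> //=; rewrite addrC.
rewrite integral_cst; last exact: measurableI.
by rewrite EFinM -(lenE (mfinI_itv 0 1 mY)).
Qed.

(** The mean over [0, 1] lies between the extreme values of a continuous function, so the
    intermediate value theorem attains it. *)
Lemma corr_average X Y : closed X -> closed Y -> periodic X ->
  exists e, corr X Y e = clen X * clen Y.
Proof.
move=> cX cY pX; have mX := closed_measurable cX; have mY := closed_measurable cY.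
have cc := corr_continuous cX cY pX.
have ccw a b : {within `[a, b], continuous (corr X Y)} by exact: continuous_subspaceT.
have mc : measurable_fun (`[0, 1] : set (measurableTypeR R)) (EFin \o corr X Y).
  apply/measurable_EFinP; apply: measurable_funTS.
  exact: continuous_measurable_fun.
have m01 : mu `[0%R, 1%R] = 1%E by rewrite lenE ?len_itv ?subr0//; exact: mfin_itv.
have intc c : (\int[mu]_(e in `[0%R, 1%R]) cst c%:E e = c%:E)%E.
  by rewrite integral_cst// [X in (_ * X)%E]m01 mule1.
have [e0 _ e0P] := EVT_min (@ler01 R) (ccw 0 1).
have [e1 _ e1P] := EVT_max (@ler01 R) (ccw 0 1).
have le0 : corr X Y e0 <= clen X * clen Y.
  rewrite -lee_fin -integral_corr// -intc; apply: ge0_le_integral => //.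
  by move=> x _; rewrite lee_fin clen_ge0.
have le1 : clen X * clen Y <= corr X Y e1.
  rewrite -lee_fin -integral_corr// -[leRHS]intc; apply: ge0_le_integral => //.
  by move=> x _; rewrite lee_fin clen_ge0.
case: (leP e0 e1) => [e01|/ltW e10].
  have [|e _ <-] := IVT e01 (ccw e0 e1) (v := clen X * clen Y); last by exists e.
  by rewrite ge_min le_max le0 le1 orbT.
have [|e _ <-] := IVT e10 (ccw e1 e0) (v := clen X * clen Y); last by exists e.
by rewrite ge_min le_max le0 le1 orbT.
Qed.

Lemma sumsetC X Y : sumset X Y = sumset Y X.
Proof. by apply/seteqP; split=> _ [a [b [Xa Yb ->]]]; exists b, a; rewrite addrC. Qed.

(** The sum contains a translate of X. *)
Lemma clen_sumset_ge X Y : closed X -> closed Y -> periodic X -> periodic Y ->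
  Y !=set0 -> clen X <= clen (sumset X Y).
Proof.
move=> cX cY pX pY [y Yy].
rewrite -(clen_shift (- y) (closed_measurable cX) pX).
apply: le_clen; first by apply: closed_measurable; exact: closed_sumset.
by move=> x Xx; exists (x - y), y; rewrite subrK.
Qed.

(* Replacing (X, Y) by (X `|` (Y + e), Y `&` (X - e)) keeps clen X + clen Y and
   does not enlarge X + Y; for a suitable e it multiplies clen Y by clen X <= q. *)
Lemma raikov_iter (i : nat) X Y (q : R) :
  closed X -> closed Y -> periodic X -> periodic Y ->
  X !=set0 -> Y !=set0 -> clen (sumset X Y) <= q ->
  clen X + clen Y - clen Y * q ^+ i <= clen (sumset X Y).
Proof.
elim: i X Y => [|i IH] X Y cX cY pX pY X0 Y0 leq.
  by rewrite expr0 mulr1 addrK; exact: clen_sumset_ge.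
have Xle := clen_sumset_ge cX cY pX pY Y0.
have Yle := clen_sumset_ge cY cX pY pX X0; rewrite sumsetC in Yle.
have q0 : 0 <= q by exact: le_trans (clen_ge0 _) leq.
have Yq0 j : 0 <= clen Y * q ^+ j by rewrite mulr_ge0 ?clen_ge0 ?exprn_ge0.
have [Xz|Xnz] := eqVneq (clen X) 0; first by have := Yq0 i.+1; lra.
have [Yz|Ynz] := eqVneq (clen Y) 0; first by have := Yq0 i.+1; lra.
have [e eE] := corr_average cX cY pX.
pose X' := X `|` shift (- e) Y; pose Y' := Y `&` shift e X.
have cX' : closed X' by apply: closedU => //; exact: closed_shift.
have cY' : closed Y' by apply: closedI => //; exact: closed_shift.
have pX' : periodic X' by apply: periodicU => //; exact: periodic_shift.
have pY' : periodic Y' by apply: periodicI => //; exact: periodic_shift.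
have X'0 : X' !=set0 by case: X0 => x Xx; exists x; left.
have Y'0 : Y' !=set0.
  apply/set0P/negP => /eqP Y'0; move: eE; rewrite /corr -/Y' Y'0 /clen set0I len_set0.
  by move/esym/eqP; rewrite mulf_eq0 (negbTE Xnz) (negbTE Ynz).
have sub : sumset X' Y' `<=` sumset X Y.
  move=> _ [a [b [[Xa|Ya] [Yb Xb] ->]]]; first by exists a, b.
  by exists (b + e), (a - e); split=> //; rewrite addrACA subrr addr0 addrC.
have lesum : clen (sumset X' Y') <= clen (sumset X Y).
  by apply: le_clen sub; apply: closed_measurable; exact: closed_sumset.
have {}IH := IH X' Y' cX' cY' pX' pY' X'0 Y'0 (le_trans lesum leq).
have mX := closed_measurable cX; have mY := closed_measurable cY.
have totE : clen X' + clen Y' = clen X + clen Y.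
  rewrite -(clen_shift (- e) mY pY) -[RHS]clenUI//; last exact: measurable_shift.
  congr (_ + _); rewrite -(clen_shift (- e) (closed_measurable cY') pY').
  congr clen; apply/seteqP; split=> x; rewrite /shift/= /Y' /shift/=.
    by move=> [Yx]; rewrite /= subrK => Xx.
  by move=> [Xx Yx]; split=> //=; rewrite subrK.
have Y'E : clen Y' = clen X * clen Y by rewrite -eE.
apply: le_trans lesum; apply: le_trans IH; rewrite totE lerD2l lerN2 Y'E exprS.
rewrite mulrCA mulrA ler_wpM2r ?exprn_ge0// ler_wpM2r ?clen_ge0//.
exact: le_trans Xle leq.
Qed.

(** Since q < 1, the error term [clen Y * q ^+ i] of the iteration eventually drops below any
    supposed positive gap. *)
Theorem raikov X Y : closed X -> closed Y -> periodic X -> periodic Y ->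
  X !=set0 -> Y !=set0 -> clen (sumset X Y) < 1 ->
  clen X + clen Y <= clen (sumset X Y).
Proof.
move=> cX cY pX pY X0 Y0 lt1; rewrite leNgt; apply/negP => gap.
set q := clen (sumset X Y) in lt1 gap.
have q1 : `|q| < 1 by rewrite ger0_norm ?clen_ge0.
have gap0 : 0 < clen X + clen Y - q by rewrite subr_gt0.
have [i _ /(_ i (leqnn i)) /=] := cvgr0_norm_lt _ (cvg_expr q1) _ gap0.
rewrite ger0_norm ?exprn_ge0 ?clen_ge0// => qi.
have := raikov_iter i cX cY pX pY X0 Y0 (lexx _); rewrite -/q.
have : clen Y * q ^+ i <= q ^+ i.
  by rewrite -[leRHS]mul1r ler_wpM2r ?exprn_ge0 ?clen_ge0 ?clen_le1.
by lra.
Qed.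

End raikov.

(** * Sumsets of compact sets of given diameter *)

Section diameter.
Context {R : realType}.
Implicit Types (A B C K S : set R) (a b c e k m x y z u v M : R).

(* Each point of K lies in K + K twice modulo 1, because K contains both 0 and 1. *)
Lemma len_sumset_self01 K : compact K -> K `<=` `[0, 1] -> K 0 -> K 1 ->
  3 * len K <= len (sumset K K) \/ len K + 1 <= len (sumset K K).
Proof.
move=> cK K01 K0 K1; set S := sumset K K; set P := periodize K.
have Kb x : K x -> 0 <= x <= 1 by move=> /K01; rewrite /= in_itv.
have cS : compact S by exact: compact_sumset.
have mS := compact_measurable cS.
have mS1 : measurable (shift 1 S) by exact: measurable_shift.
have S02 : S `<=` `[0, 2].
  move=> _ [a [b [/Kb/andP[? ?] /Kb/andP[? ?] ->]]] /=.
  by rewrite in_itv/=; apply/andP; split; lra.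
have SE : len S = clen S + clen (shift 1 S).
  rewrite -{1}(setIidl S02) (@len_split _ _ _ 1)//; last by apply/andP; split; lra.
  congr (_ + _); rewrite -(len_translate 1); last exact: mfinI_itv.
  congr len; apply/seteqP; split=> x; rewrite /shift/= !in_itv/= => -[Sx /andP[? ?]].
    by split=> //; apply/andP; split; lra.
  by split=> //; apply/andP; split; lra.
have PK : P `&` `[0, 1] = K.
  apply/seteqP; split=> [x [[n Kxn]]|x Kx]; last first.
    by split; [exists 0; rewrite addr0|exact: K01].
  rewrite /= in_itv/= => /andP[x0 x1]; have /andP[? ?] := Kb _ Kxn.
  have : (-1 <= n <= 1)%R by rewrite -!(ler_int R) /=; apply/andP; split; lra.
  (* The bounds force x = 1 for n = -1 and x = 0 for n = 1; both points are in K. *)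
  move=> n1; have [nE|[nE|nE]] : n = -1 \/ n = 0 \/ n = 1 by lia.
  - rewrite (_ : x = 1)//; have : n%:~R = -1 :> R by rewrite nE.
    lra.
  - by move: Kxn; rewrite nE addr0.
  - rewrite (_ : x = 0)//; have : n%:~R = 1 :> R by rewrite nE.
    lra.
have cP : closed P by exact: closed_periodize.
have pP : periodic P by exact: periodic_periodize.
have P0 : P !=set0 by exists 0, 0; rewrite addr0.
have sumP : clen (sumset P P) <= clen (S `|` shift 1 S).
  apply: le_len; first by apply: mfinI_itv; exact: measurableU.
  move=> x [[a [b [[i Ka] [j Kb']]]] xE x01]; split=> //.
  have Sx : S (x + (i + j)%:~R).
    by exists (a + i%:~R), (b + j%:~R); split=> //; rewrite xE mulrzDr; ring.
  move: x01 (S02 _ Sx); rewrite /= !in_itv/= => /andP[x0 x1] /andP[s0 s2].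
  set n := i + j in Sx s0 s2.
  have n2 : (-1 <= n <= 2)%R by rewrite -!(ler_int R) /=; apply/andP; split; lra.
  (* The extreme cases force x = 1 = 0 + 1 and x = 0 = 0 + 0, which are sums from K. *)
  have [nE|[nE|[nE|nE]]] : n = -1 \/ n = 0 \/ n = 1 \/ n = 2 by lia.
  - left; exists 0, 1; split=> //; have : n%:~R = -1 :> R by rewrite nE.
    lra.
  - by left; move: Sx; rewrite nE addr0.
  - by right; move: Sx; rewrite nE.
  - left; exists 0, 0; split=> //; have : n%:~R = 2 :> R by rewrite nE.
    lra.
have KSS : len K <= clen (S `&` shift 1 S).
  apply: le_len; first by apply: mfinI_itv; exact: measurableI.
  move=> x Kx; split; last exact: K01.
  by split; [exists 0, x; rewrite add0r|exists x, 1].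
(* Inclusion-exclusion yields |S| >= |P + P| + |K|, and by Raikov |P + P| is at least 1 or at least
   2|K|. *)
have := clenUI mS mS1; have clenP : clen P = len K by rewrite /clen PK.
case: (ltP (clen (sumset P P)) 1) => [lt1|]; last by right; lra.
by left; have := raikov cP cP pP pP P0 P0 lt1; lra.
Qed.

(** A continuous analogue of Freiman's 3k - 3 theorem. The affine map taking [m, M] to [0, 1]
    reduces it to the normalized case; if m = M then K is null. *)
Lemma len_sumset_self K m M : compact K -> K m -> K M ->
  (forall x, K x -> m <= x <= M) ->
  3 * len K <= len (sumset K K) \/ len K + (M - m) <= len (sumset K K).
Proof.
move=> cK Km KM KmM; have /andP[_] := KmM _ Km; rewrite le_eqVlt => /predU1P[mM|mM].
  left; rewrite (_ : len K = 0) ?mulr0 ?len_ge0//; apply/le_anti; rewrite len_ge0 andbT.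
  rewrite -(subrr m) {1}mM -len_itv -?mM//; apply: le_len; first exact: mfin_itv.
  by move=> x /KmM; rewrite /= in_itv/= -mM.
have d0 : 0 < M - m by lra.
pose K' := [set x | K ((M - m) * x + m)].
have clK : closed K by apply: compact_closed => //; exact: Rhausdorff.
have K'01 : K' `<=` `[0, 1].
  move=> x /KmM; rewrite /= in_itv/= => /andP[h1 h2].
  by rewrite -(ler_pM2l d0) -(ler_pM2l d0 x); apply/andP; split; lra.
have cK' : compact K'.
  by apply: (subclosed_compact _ (@segment_compact _ 0 1) K'01); exact: closed_affine.
have mS := compact_mfin (compact_sumset cK cK).
have SE : sumset K' K' = [set x | sumset K K ((M - m) * x + (m + m))].
  apply/seteqP; split=> x.
    by move=> [a [b [Ka Kb ->]]]; exists ((M - m) * a + m), ((M - m) * b + m); split=> //; ring.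
  move=> [a [b [Ka Kb xE]]]; have d1 : M - m != 0 by rewrite gt_eqF.
  exists ((a - m) / (M - m)), ((b - m) / (M - m)); split.
  - by rewrite /K'/= mulrC divfK// subrK.
  - by rewrite /K'/= mulrC divfK// subrK.
  - apply: (mulfI d1); rewrite mulrDr ![(M - m) * (_ / _)]mulrC !divfK//; lra.
have := @len_sumset_self01 K' cK' K'01.
rewrite /K'/= mulr0 add0r mulr1 subrK -/K' SE !len_affine//; last exact: compact_mfin.
move=> /(_ Km KM); set d := M - m in d0 *.
have di : 0 < d^-1 by rewrite invr_gt0.
rewrite mulrCA ler_pM2l//; case; first by left.
have <- : d^-1 * d = 1 by rewrite mulVf// gt_eqF.
by rewrite -mulrDr ler_pM2l//; right.
Qed.

Lemma len_sumset_self_ge K : compact K -> 2 * len K <= len (sumset K K).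
Proof.
move=> cK; have [->|/set0P K0] := eqVneq K set0.
  by rewrite len_set0 mulr0 len_ge0.
have [m Km mP] := compact_minP cK K0; have [M KM MP] := compact_maxP cK K0.
have KmM x : K x -> m <= x <= M by move=> Kx; rewrite mP ?MP.
have le : len K <= M - m.
  rewrite -len_itv ?MP//; apply: le_len; first exact: mfin_itv.
  by move=> x /KmM; rewrite /= in_itv.
by have := len_ge0 K; case: (len_sumset_self cK Km KM KmM); lra.
Qed.

(** S and 3B are disjoint subsets of [u, v]. The dilate 3B is written as a preimage under x -> x /
    3, the form that [len_affine] measures. *)
Lemma len_add_triple_le S B u v : compact S -> compact B -> u <= v ->
  (forall x, S x -> u <= x <= v) -> (forall x, B x -> u <= 3 * x <= v) ->
  (forall x, B x -> ~ S (3 * x)) -> len S + 3 * len B <= v - u.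
Proof.
move=> cS cB uv Suv Buv SB.
have mS := compact_mfin cS; have mB := compact_mfin cB.
have i3 : 0 < 3^-1 :> R by rewrite invr_gt0.
have -> : 3 * len B = len [set x | B (3^-1 * x + 0)].
  by rewrite len_affine// invrK.
have div3 x : 3 * (3^-1 * x + 0) = x by rewrite addr0 mulrA divff ?mul1r.
rewrite -len_disjU//; first last.
- apply/seteqP; split=> // x [Sx /= Bx]; apply: (SB _ Bx); by rewrite div3.
- exact: mfin_affine.
rewrite -len_itv//; apply: le_len; first exact: mfin_itv.
move=> x [/Suv|/= /Buv]; first by rewrite /= in_itv.
by rewrite div3 in_itv.
Qed.

(** * Compact sets without solutions of x + y = 3z *)

Definition sum_triple_free K := forall x y z, K x -> K y -> K z -> x + y <> 3 * z.

Lemma sum_triple_freeS A B : A `<=` B -> sum_triple_free B -> sum_triple_free A.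
Proof. by move=> AB fB x y z /AB Bx /AB By /AB Bz; exact: fB. Qed.

(** The cut 2M/3 selects the z with 3z <= 2M, so that 3z falls in [2m, 2M] next to K + K; the two
    cases are those of [len_sumset_self]. *)
Lemma len_lower_part K m M : compact K -> sum_triple_free K ->
  0 <= m -> K m -> K M ->
  (forall x, K x -> m <= x <= M) ->
  let b := len (K `&` `[0, 2 / 3 * M]) in
  3 * len K + 3 * b <= 2 * (M - m) \/ len K + 3 * b <= M - m.
Proof.
move=> cK fK m0 Km KM KmM /=; have /andP[_ mM] := KmM _ Km.
have : len (sumset K K) + 3 * len (K `&` `[0, 2 / 3 * M]) <= 2 * M - 2 * m.
  apply: len_add_triple_le.
  - exact: compact_sumset.
  - exact: compactI_itv.
  - lra.
  - move=> _ [a [b [/KmM/andP[? ?] /KmM/andP[? ?] ->]]]; by apply/andP; split; lra.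
  - move=> x [/KmM/andP[? ?]]; rewrite /= in_itv/= => /andP[? ?]; by apply/andP; split; lra.
  - by move=> x [Kx _] [a [b [Ka Kb]]] /esym; exact: fK.
by case: (len_sumset_self cK Km KM KmM) => ? ?; [left|right]; lra.
Qed.

Lemma len_splitU_le K a b c : measurable K ->
  len (K `&` `[a, c]) <= len (K `&` `[a, b]) + len (K `&` `[b, c]).
Proof.
move=> mK; rewrite (le_trans _ (lenU_le (mfinI_itv a b mK) (mfinI_itv b c mK)))//.
apply: le_len; first by apply: mfinU; exact: mfinI_itv.
move=> x [Kx]; rewrite /= in_itv/= => /andP[ax xc].
case: (leP x b) => [xb|/ltW bx]; [left|right]; split=> //; rewrite /= in_itv/=.
  by rewrite ax xb.
by rewrite bx xc.
Qed.

Lemma lenI_itv_le K a b : a <= b -> len (K `&` `[a, b]) <= b - a.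
Proof. by move=> ab; rewrite -len_itv//; apply: le_len; [exact: mfin_itv|exact: subIsetr]. Qed.

(** Bound the part of K above 2M/3 trivially by M/3. The second case of [len_lower_part] gives M/2 -
    m/4, the first even M/2 - m/3. *)
Lemma len_sum_triple_free_half K m M : compact K -> sum_triple_free K ->
  0 <= m -> K m -> K M ->
  (forall x, K x -> m <= x <= M) -> len K <= M / 2 - m / 4.
Proof.
move=> cK fK m0 Km KM KmM; have /andP[_ mM] := KmM _ Km.
have mK := compact_measurable cK.
have KE : K `&` `[0, M] = K.
  by apply: setIidl => x /KmM /andP[? ?]; rewrite /= in_itv/=; apply/andP; split; lra.
have := @len_splitU_le K 0 (2 / 3 * M) M mK; rewrite KE.
have : len (K `&` `[2 / 3 * M, M]) <= M - 2 / 3 * M by apply: lenI_itv_le; lra.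
by case: (len_lower_part cK fK m0 Km KM KmM) => /=; lra.
Qed.

(** The constant comes from eliminating d between |K| <= 13M/27 + d/3 and 6|K| + 3d <= 3M; the
    alternative 4|K| + 3d <= 2M gives the smaller 19/39. *)
Theorem len_sum_triple_free K m M : compact K -> sum_triple_free K ->
  0 <= m -> K m -> K M ->
  (forall x, K x -> m <= x <= M) -> len K <= 22 / 45 * M.
Proof.
move=> cK fK m0 Km KM KmM; have /andP[_ mM] := KmM _ Km.
have mK := compact_measurable cK.
pose C := K `&` `[2 / 3 * M, M].
have cC : compact C by exact: compactI_itv.
have CP x : C x -> K x /\ 2 / 3 * M <= x <= M by case; rewrite /= in_itv.
have KE : K `&` `[0, M] = K.
  by apply: setIidl => x /KmM /andP[? ?]; rewrite /= in_itv/=; apply/andP; split; lra.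
(* C + C lies in [4M/3, 2M], which is three times this window. *)
have I4 : 3 * len (K `&` `[4 / 9 * M, 2 / 3 * M]) <= 2 / 3 * M - 2 * len C.
  have : len (sumset C C) + 3 * len (K `&` `[4 / 9 * M, 2 / 3 * M]) <= 2 * M - 4 / 3 * M.
    apply: len_add_triple_le.
    - exact: compact_sumset.
    - exact: compactI_itv.
    - lra.
    - move=> _ [a [b [/CP[_ /andP[? ?]] /CP[_ /andP[? ?]] ->]]]; by apply/andP; split; lra.
    - move=> x [_]; rewrite /= in_itv/= => /andP[? ?]; by apply/andP; split; lra.
    - by move=> x [Kx _] [a [b [/CP[Ka _] /CP[Kb _]]]] /esym; exact: fK.
  by have := len_sumset_self_ge cC; lra.
(* Likewise x + C lies in [x + 2M/3, x + M], three times this window. *)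
have shiftC x : K x -> 3 * len (K `&` `[2 / 9 * M + x / 3, M / 3 + x / 3]) <= M / 3 - len C.
  move=> Kx; rewrite -(len_translate (- x) (compact_mfin cC)).
  have : len (shift (- x) C) + 3 * len (K `&` `[2 / 9 * M + x / 3, M / 3 + x / 3]) <=
      (x + M) - (x + 2 / 3 * M).
    apply: len_add_triple_le.
    - apply: (subclosed_compact _ (@segment_compact _ (2 / 3 * M + x) (M + x))).
        by apply: closed_shift; apply: compact_closed => //; exact: Rhausdorff.
      by move=> y /CP[_ /andP[? ?]]; rewrite /= in_itv/=; apply/andP; split; lra.
    - exact: compactI_itv.
    - lra.
    - by move=> y /CP[_ /andP[? ?]]; apply/andP; split; lra.
    - by move=> y [_]; rewrite /= in_itv/= => /andP[? ?]; apply/andP; split; lra.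
    - by move=> y [Ky _] /CP[Kyx _]; apply: (fK _ _ _ Kx Kyx Ky); lra.
  by lra.
(* With x the maximum of this part, the window of x reaches past x and starts at 2M/9 + x/3, at most
   M/27 above M/3. *)
have I3 : len (K `&` `[M / 3, 4 / 9 * M]) <= M / 27 + (M / 3 - len C) / 3.
  have Cle : len C <= M - 2 / 3 * M by apply: lenI_itv_le; lra.
  have [->|/set0P K30] := eqVneq (K `&` `[M / 3, 4 / 9 * M]) set0.
    by rewrite len_set0; lra.
  have cK3 : compact (K `&` `[M / 3, 4 / 9 * M]) by exact: compactI_itv.
  have [x [Kx]] := compact_maxP cK3 K30; rewrite /= in_itv/= => /andP[x1 x2] xP.
  have := shiftC x Kx; have : len (`[M / 3, 2 / 9 * M + x / 3]) = 2 / 9 * M + x / 3 - M / 3.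
    by apply: len_itv; lra.
  have : len (K `&` `[M / 3, 4 / 9 * M]) <=
      len (`[M / 3, 2 / 9 * M + x / 3]) + len (K `&` `[2 / 9 * M + x / 3, M / 3 + x / 3]).
    rewrite (le_trans _ (lenU_le (mfin_itv _ _) (mfinI_itv _ _ mK)))//.
    apply: le_len; first by apply: mfinU; [exact: mfin_itv|exact: mfinI_itv].
    move=> y Ky; have := xP y Ky; case: Ky => Ky; rewrite /= !in_itv/= => /andP[y1 y2] yx.
    case: (leP y (2 / 9 * M + x / 3)) => [?|/ltW ?]; [left|right]; first by rewrite y1.
    by split=> //; apply/andP; split; lra.
  by lra.
(* The half bound for a maximum x <= 2M/9 + m/3 gives M/9 + m/6 - m/4; the term -m/4 absorbs m/6. *)
have I1 : len (K `&` `[0, 2 / 9 * M + m / 3]) <= M / 9.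
  set E := K `&` _; have cE : compact E by exact: compactI_itv.
  have [->|/set0P E0] := eqVneq E set0; first by rewrite len_set0; lra.
  have [x [Kx]] := compact_maxP cE E0; rewrite /= in_itv/= => /andP[x1 x2] xP.
  have Em : E m.
    by split=> //; rewrite /= in_itv/= m0/=; have /andP[? _] := KmM _ Kx; lra.
  have fE : sum_triple_free E by apply: sum_triple_freeS fK; exact: subIsetl.
  have Ex : E x by split=> //; rewrite /= in_itv/= x1 x2.
  have := len_sum_triple_free_half cE fE m0 Em Ex.
  suff EmP y : E y -> m <= y <= x by move=> /(_ EmP); lra.
  by move=> Ey; rewrite xP// andbT; case: Ey => /KmM/andP[].
have I2 := shiftC m Km.
have s1 := @len_splitU_le K 0 (2 / 3 * M) M mK; rewrite KE -/C in s1.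
have s2 := @len_splitU_le K 0 (4 / 9 * M) (2 / 3 * M) mK.
have s3 := @len_splitU_le K 0 (2 / 9 * M + m / 3) (4 / 9 * M) mK.
(* As m >= 0, the window of m ends at or beyond M/3, leaving no gap before the next piece. *)
have s4 : len (K `&` `[2 / 9 * M + m / 3, 4 / 9 * M]) <=
    len (K `&` `[2 / 9 * M + m / 3, M / 3 + m / 3]) + len (K `&` `[M / 3, 4 / 9 * M]).
  rewrite (le_trans (len_splitU_le _ (M / 3 + m / 3) _ mK))// lerD2l.
  apply: le_len; first exact: mfinI_itv.
  by move=> y [Ky]; rewrite /= !in_itv/= => /andP[? ?]; split=> //; apply/andP; split; lra.
by case: (len_lower_part cK fK m0 Km KM KmM) => /=; lra.
Qed.

End diameter.

(** * Reduction of the measurable case to compact sets *)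

Theorem theorem1 (R : realType) (A : set R)
  (Ameas : lebesgue_measurable A)
  (A01 : A `<=` `[0, 1])
  (Afree : ~ exists x y z : R, [/\ A x, A y, A z & x + y = 3 * z]) :
  (completed_lebesgue_measure A <= (1 / 2 - 1 / 114)%:E)%E.
Proof.
have fA : sum_triple_free A.
  by move=> x y z Ax Ay Az xyz; apply: Afree; exists x, y, z.
move: Ameas; rewrite /lebesgue_measurable -completed_caratheodory_measurable.
(* A is a Borel set F together with a subset N of a Borel null set N'. *)
rewrite g_sigma_completed_algebra_genE => -[F mF [N [N' [mN' N'0 NN']] FNA]].
have -> : completed_lebesgue_measure A = lebesgue_measure A by [].
apply: (@le_trans _ _ (lebesgue_measure F)).
  rewrite -FNA -[leRHS]adde0 -N'0 (@le_trans _ _ (lebesgue_measure (F `|` N')))//.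
    by apply: le_outer_measure; exact: setUS.
  exact: outer_measureU2.
(* The measure of F is the supremum over its compact subsets, which inherit solution-freeness from
   A. *)
rewrite lebesgue_regularity_inner_sup//; apply: ge_ereal_sup => _ [K [cK KF] <-].
have KA : K `<=` A by rewrite -FNA; apply: subset_trans KF _; exact: subsetUl.
suff : len K <= 1 / 2 - 1 / 114 by rewrite -lee_fin -(lenE (compact_mfin cK)).
have [->|/set0P K0] := eqVneq K set0; first by rewrite len_set0; lra.
have [m Km mP] := compact_minP cK K0; have [M KM MP] := compact_maxP cK K0.
have KmM x : K x -> m <= x <= M by move=> Kx; rewrite mP ?MP.
have /andP[m0 _] : 0 <= m <= 1 by have := A01 _ (KA _ Km); rewrite /= in_itv.
have /andP[_ M1] : 0 <= M <= 1 by have := A01 _ (KA _ KM); rewrite /= in_itv.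
(* Here M <= 1, and 22/45 is less than 28/57 = 1/2 - 1/114. *)
have := len_sum_triple_free cK (sum_triple_freeS KA fA) m0 Km KM KmM.
by lra.
Qed.
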